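(* Let $q\ge 1$ and $m\ge 2$ be integers and let $\beta=\beta_{q,m}\in(q,q+1)$ be the generalized multinacci number, i.e. the real root in $(q,q+1)$ of $x^m=qx^{m-1}+qx^{m-2}+\cdots+q$. Then $T_{-\beta}$ has the matching property.
   Context: For a real number $\beta>1$, the negative $\beta$-transformation is $T_{-\beta}:(0,1]\to(0,1]$, $T_{-\beta}(x)=-\beta x+\lfloor \beta x\rfloor+1$. It is extended to $0$ by setting $T_{-\beta}(0):=1$, and $T_{-\beta}^n(0):=T_{-\beta}(T_{-\beta}^{n-1}(0))$ for $n\ge 2$. One says that $T_{-\beta}$ has the matching property if there exists an integer $n\ge 1$ such that $T_{-\beta}^n(0)=T_{-\beta}^n(1)$. *)

(* Defs.v *)
From HB Require Import structures.
From mathcomp Require Import all_boot all_order all_algebra.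
From mathcomp Require Import reals.
Set Implicit Arguments.
Unset Strict Implicit.
Unset Printing Implicit Defensive.
Import Order.TTheory GRing.Theory Num.Theory.
Local Open Scope ring_scope.

(* The transformation acts on (0, 1] and is extended to 0; values of this
   total function outside [0, 1] are irrelevant. *)
Definition neg_beta_transformation (R : realType) (beta x : R) : R :=
  if x == 0 then 1 else - (beta * x) + (Num.floor (beta * x))%:~R + 1.

Definition has_matching (R : realType) (beta : R) : Prop :=
  exists n : nat, (1 <= n)%N /\
    iter n (neg_beta_transformation beta) 0 =
    iter n (neg_beta_transformation beta) 1.

(* For integers q >= 1 and m >= 2 exactly one real number satisfies this. *)
Definition is_generalized_multinacci (R : realType) (q m : nat) (beta : R)
    : Prop :=
  [/\ q%:R < beta, beta < q%:R + 1 &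
      beta ^+ m = \sum_(i < m) q%:R * beta ^+ i].

(* Main.v *)
Require Import Defs.
From mathcomp Require Import all_boot all_order all_algebra.
From mathcomp Require Import reals.
From mathcomp Require Import ring lra.
Import Order.TTheory GRing.Theory Num.Theory.
Local Open Scope ring_scope.

(** Since [T 0 = 1], matching means that the orbit of 1 reaches a fixed point.
    Put [e = q + 1 - beta]; the equation of [beta] says
    [e * (1 + beta + ... + beta^(m-1)) = 1].  For [k <= m], the point
    [T^k 1] is [s k] for odd [k] and [1 - s k] for even [k], where
    [s k = e * (beta^(k-1) + beta^(k-3) + ...)].  As
    [s k + s (k+1) = e * (1 + ... + beta^k)], one gets [s (m-1) + s m = 1],
    that is, [T^(m-1) 1 = T^m 1]. *)

Lemma neg_beta_transformation_floor (R : realType) (beta x : R) (n : nat) :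
  x != 0 -> n%:R <= beta * x < n%:R + 1 ->
  neg_beta_transformation beta x = - (beta * x) + n%:R + 1.
Proof.
move=> x0 hx; rewrite /neg_beta_transformation (negbTE x0).
suff -> : Num.floor (beta * x) = n%:Z by [].
by apply: floor_def; rewrite intrD.
Qed.

Fixpoint alternate_sum (R : realType) (beta e : R) (k : nat) : R :=
  if k is j.+1 then beta * alternate_sum R beta e j + (if odd j then 0 else e)
  else 0.
Arguments alternate_sum {R}.

Definition orbit_point (R : realType) (beta e : R) (k : nat) : R :=
  if odd k then alternate_sum beta e k else 1 - alternate_sum beta e k.
Arguments orbit_point {R}.

Lemma alternate_sum_gt0 (R : realType) (beta e : R) (k : nat) :
  0 < beta -> 0 < e -> 0 < alternate_sum beta e k.+1.
Proof.
move=> b0 e0; elim: k => [|k IHk]; first by rewrite /= mulr0 add0r.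
rewrite [alternate_sum _ _ _]/= -/(alternate_sum beta e k.+1).
by apply: ltr_wpDr; [case: ifP => // _; exact: ltW | exact: mulr_gt0].
Qed.

(** Of two consecutive steps of the recursion exactly one adds [e], so both sides satisfy
    [u (k+1) = beta * u k + e]. *)
Lemma alternate_sumDS (R : realType) (beta e : R) (k : nat) :
  alternate_sum beta e k + alternate_sum beta e k.+1 =
  e * \sum_(i < k.+1) beta ^+ i.
Proof.
elim: k => [|k IHk]; first by rewrite big_ord1 /= mulr0 !add0r expr0 mulr1.
have -> : \sum_(i < k.+2) beta ^+ i = 1 + beta * \sum_(i < k.+1) beta ^+ i.
  by rewrite big_ord_recl mulr_sumr; congr (_ + _); apply: eq_bigr => i _;
    rewrite exprS.
rewrite mulrDr mulrCA -IHk /=; case: (odd k) => /=; ring.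
Qed.

(** For odd [k], [beta * s k = s (k+1)] has floor 0; for even [k],
    [beta * (1 - s k) = q + 1 - s (k+1)] has floor [q]. *)
Lemma neg_beta_transformation_orbit_point (R : realType) (beta : R) (q k : nat) :
  0 < beta -> let e := q%:R + 1 - beta in 0 < e ->
  alternate_sum beta e k + alternate_sum beta e k.+1 <= 1 ->
  neg_beta_transformation beta (orbit_point beta e k) =
  orbit_point beta e k.+1.
Proof.
move=> b0 e e0 le1.
have s1 := alternate_sum_gt0 R beta e k b0 e0.
move: le1 s1; rewrite /orbit_point /=.
have : 0 <= alternate_sum beta e k.
  by case: k => // k; apply/ltW/alternate_sum_gt0.
(* Strictness fails at [k = 0]. For odd [k] it makes the point nonzero and turns the bound into
   [beta * s k < 1]. *)
have : odd k -> 0 < alternate_sum beta e k.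
  by case: k => // k _; apply: alternate_sum_gt0.
move: (alternate_sum beta e k) => s; case: (odd k) => /= sk s0 le1 s1.
  have {}sk := sk isT.
  by rewrite (@neg_beta_transformation_floor _ _ _ 0);
    [ring | rewrite gt_eqF | apply/andP; split; lra].
rewrite (@neg_beta_transformation_floor _ _ _ q); first by rewrite /e; ring.
  by rewrite gt_eqF //; lra.
by rewrite /e in le1 s1 *; apply/andP; split; lra.
Qed.

Theorem theorem1p4 (R : realType) (q m : nat) (beta : R)
    (hq : (1 <= q)%N) (hm : (2 <= m)%N)
    (hbeta : is_generalized_multinacci q m beta) :
  has_matching beta.
Proof.
case: hbeta => qb bq hb; pose e : R := q%:R + 1 - beta.
have b0 : 0 < beta by apply: le_lt_trans qb; exact: ler0n.
have e0 : 0 < e by rewrite subr_gt0.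
have sum1 : e * \sum_(i < m) beta ^+ i = 1.
  (* Eliminate [beta ^+ m] between [beta ^+ m = q * S] and [beta ^+ m - 1 = (beta - 1) * S]. *)
  move: hb (subrX1 beta m); rewrite -mulr_sumr /e.
  by move: (\sum_(i < m) _) => S; lra.
have le1 k : (k < m)%N ->
    alternate_sum beta e k + alternate_sum beta e k.+1 <= 1.
  (* A partial sum of nonnegative terms is at most the full sum. *)
  move=> km; rewrite alternate_sumDS -sum1 ler_pM2l //.
  rewrite -!(big_mkord xpredT (fun i => beta ^+ i)).
  rewrite (big_cat_nat _ (n := k.+1) (p := m)) //= lerDl.
  by apply: sumr_ge0 => i _; rewrite exprn_ge0 // ltW.
have orbit k : (k <= m)%N ->
    iter k (neg_beta_transformation beta) 1 = orbit_point beta e k.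
  elim: k => [|k IHk] km; first by rewrite /orbit_point /= subr0.
  rewrite iterS IHk; last exact: ltnW.
  exact: neg_beta_transformation_orbit_point (le1 _ km).
case: m hm hb sum1 le1 orbit => // m _ _ sum1 _ orbit.
(* The exponent of the equation is now [m.+1]. Since 0 maps to 1, it remains to equate the orbit
   points of index [m] and [m.+1]; for either parity of [m] this is [s m + s (m+1) = 1]. *)
exists m.+1; split => //.
rewrite iterSr {2}/neg_beta_transformation eqxx !orbit //.
move: sum1; rewrite -alternate_sumDS /orbit_point [odd m.+1]/=.
by case: (odd m) => /= h; lra.
Qed.
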